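(* If $\pi$ is a continuous possibility distribution on the real line such that $[\pi,\pi]$ is a (thin) cloud, i.e. $\pi(r)=1$ for some $r$ and $\pi(r')=0$ for some $r'$, then the credal set $\mathcal{P}_{[\pi,\pi]}=\mathcal{P}_\pi\cap\mathcal{P}_{1-\pi}$ is not empty.
   Context: Clouds and possibility distributions on the real line considered here are defined on a bounded interval $[\underline{r},\overline{r}]\subset\mathbb{R}$ (sets written $\{r\in\mathbb{R}\mid\ldots\}$ are understood within this domain), and $P$ ranges over $\sigma$-additive probability measures. A possibility distribution $\pi$ is a mapping with values in $[0,1]$ taking the value $1$ at least once. Its credal set is $\mathcal{P}_\pi=\{P\mid\forall\alpha\in[0,1],\ 1-\alpha\le P(\{r\in\mathbb{R}\mid\pi(r)>\alpha\})\}$. A cloud $[\delta,\pi]$ is a pair of $[0,1]$-valued mappings with $\delta\le\pi$ pointwise, $\delta(r)=0$ for some $r$, and $\pi(r')=1$ for some $r'$. It is thin if $\delta=\pi$. Its credal set is $$\mathcal{P}_{[\delta,\pi]}=\{P\mid\forall\alpha\in[0,1],\ P(\{r\in\mathbb{R}\mid\delta(r)\ge\alpha\})\le1-\alpha\le P(\{r\in\mathbb{R}\mid\pi(r)>\alpha\})\}.$$ *)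

(* Defs.v *)
From mathcomp Require Import all_boot all_order all_algebra.
From mathcomp Require Import boolp classical_sets functions set_interval reals.
From mathcomp Require Import ereal topology normedtype measure lebesgue_measure.
Set Implicit Arguments.
Unset Strict Implicit.
Unset Printing Implicit Defensive.
Import Order.TTheory GRing.Theory Num.Theory.
Import numFieldNormedType.Exports.
Local Open Scope classical_set_scope.
Local Open Scope ring_scope.

(* Functions on the domain [lo, hi] are represented by functions R -> R whose
   values outside [lo, hi] are ignored. *)
Definition unit_valued (R : realType) (lo hi : R) (f : R -> R) : Prop :=
  forall r, r \in `[lo, hi] -> 0 <= f r <= 1.

Definition possibility_distribution (R : realType) (lo hi : R)
    (pi : R -> R) : Prop :=
  unit_valued lo hi pi /\ (exists2 r, r \in `[lo, hi] & pi r = 1).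

Definition cloud (R : realType) (lo hi : R) (delta pi : R -> R) : Prop :=
  [/\ unit_valued lo hi delta,
      unit_valued lo hi pi,
      (forall r, r \in `[lo, hi] -> delta r <= pi r),
      (exists2 r, r \in `[lo, hi] & delta r = 0) &
      (exists2 r, r \in `[lo, hi] & pi r = 1)].

Definition thin_cloud (R : realType) (lo hi : R) (delta pi : R -> R) : Prop :=
  cloud lo hi delta pi /\ (forall r, r \in `[lo, hi] -> delta r = pi r).

(* A Borel probability measure on [lo, hi] is represented by its extension by
   zero to the Borel sets of R. *)
Definition supported_in (R : realType) (lo hi : R)
    (P : probability (measurableTypeR R) R) : Prop :=
  P `[lo, hi]%classic = 1%:E.

Definition weak_cut (R : realType) (lo hi : R) (f : R -> R) (alpha : R) :
    set R :=
  [set r | r \in `[lo, hi] /\ alpha <= f r].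

Definition strict_cut (R : realType) (lo hi : R) (f : R -> R) (alpha : R) :
    set R :=
  [set r | r \in `[lo, hi] /\ alpha < f r].

(* Measures are total functions on sets, but are meaningful only on measurable
   ones: the two definitions below are intended for functions whose cuts
   are Borel. *)
Definition credal_set_possibility (R : realType) (lo hi : R) (pi : R -> R) :
    set (probability (measurableTypeR R) R) :=
  [set P | supported_in lo hi P /\
    forall alpha : R, 0 <= alpha <= 1 ->
      ((1 - alpha)%:E <= P (strict_cut lo hi pi alpha))%E].

Definition credal_set_cloud (R : realType) (lo hi : R) (delta pi : R -> R) :
    set (probability (measurableTypeR R) R) :=
  [set P | supported_in lo hi P /\
    forall alpha : R, 0 <= alpha <= 1 ->
      (P (weak_cut lo hi delta alpha) <= (1 - alpha)%:E)%E /\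
      ((1 - alpha)%:E <= P (strict_cut lo hi pi alpha))%E].

(* Main.v *)
Require Import Defs.
From HB Require Import structures.
From mathcomp Require Import all_boot all_order all_algebra.
From mathcomp Require Import boolp classical_sets functions set_interval reals.
From mathcomp Require Import ereal topology normedtype measure lebesgue_measure.
From mathcomp Require Import numfun measurable_realfun lebesgue_integral.
From mathcomp Require Import random_variable uniform_distribution.
Set Implicit Arguments.
Unset Strict Implicit.
Import Order.TTheory GRing.Theory Num.Theory.
Import numFieldNormedType.Exports.
Local Open Scope classical_set_scope.
Local Open Scope ring_scope.

(** A probability supported in the domain belongs to the credal set of the
    cloud [[pi, pi]] exactly when [pi], seen as a random variable, is uniformly
    distributed on [[0, 1]]: the two constraints at level [alpha] squeeze both
    [P {pi >= alpha}] and [P {pi > alpha}] to [1 - alpha].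

    Such a probability exists as soon as [pi] has a measurable right inverse
    [s] on [[0, 1]]: if [U] is uniform on [[0, 1]] then [pi (s U) = U], so the
    law of [s U] is in the credal set
    ([credal_set_nonempty_of_right_inverse]).  Between a zero and a one of
    [pi], the intermediate value theorem provides preimages of all levels;
    choosing the last one met on the way from the zero to the one makes the
    choice monotone in the level, hence measurable ([monotone_right_inverse],
    [measurable_right_inverse]).

    The decomposition of the credal set as an intersection is complementation:
    inside the domain, [{1 - pi > alpha}] is the complement of
    [{pi >= 1 - alpha}], so the lower bounds for [1 - pi] are the upper bounds
    of the cloud at the complementary levels ([credal_set_thin_cloudE]). *)

(** * Cuts of a continuous function *)

Lemma measurable_weak_cut (R : realType) (lo hi : R) (f : R -> R) (alpha : R) :
  {within `[lo, hi]%classic, continuous f} ->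
  measurable (weak_cut lo hi f alpha : set (measurableTypeR R)).
Proof.
move=> cf.
have -> : weak_cut lo hi f alpha = `[lo, hi]%classic `&` f @^-1` `[alpha, +oo[.
  by apply/seteqP; split=> r; rewrite /weak_cut /= !in_itv /= andbT.
exact: (subspace_continuous_measurable_fun _ cf).
Qed.

Lemma measurable_strict_cut (R : realType) (lo hi : R) (f : R -> R)
    (alpha : R) :
  {within `[lo, hi]%classic, continuous f} ->
  measurable (strict_cut lo hi f alpha : set (measurableTypeR R)).
Proof.
move=> cf.
have -> : strict_cut lo hi f alpha =
    `[lo, hi]%classic `&` f @^-1` `]alpha, +oo[.
  by apply/seteqP; split=> r; rewrite /strict_cut /= !in_itv /= andbT.
exact: (subspace_continuous_measurable_fun _ cf).
Qed.

Lemma strict_cut_compl (R : realType) (lo hi : R) (f : R -> R) (alpha : R) :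
  strict_cut lo hi (fun r => 1 - f r) alpha =
  `[lo, hi]%classic `\` weak_cut lo hi f (1 - alpha).
Proof.
apply/seteqP; split=> r /=.
  move=> [rI lt_alpha]; split=> // -[_].
  by rewrite leNgt ltrBrDr addrC -ltrBrDr lt_alpha.
move=> [rI not_cut]; split=> //; rewrite ltNge; apply/negP => le_alpha.
by apply: not_cut; split=> //; rewrite lerBlDr addrC -lerBlDr.
Qed.

Lemma supported_strict_cut_compl (R : realType) (lo hi : R) (f : R -> R)
    (alpha : R) (P : probability (measurableTypeR R) R) :
  {within `[lo, hi]%classic, continuous f} -> supported_in lo hi P ->
  P (strict_cut lo hi (fun r => 1 - f r) alpha) =
  (1 - P (weak_cut lo hi f (1 - alpha)%R))%E.
Proof.
move=> cf PI; have mW := measurable_weak_cut (1 - alpha) cf.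
rewrite strict_cut_compl measureD //.
- by congr (_ - P _)%E; [exact: PI | apply/setIidr => r []].
- by rewrite -ge0_fin_numE // fin_num_measure.
Qed.

Lemma credal_set_thin_cloudE (R : realType) (lo hi : R) (pi : R -> R) :
  {within `[lo, hi]%classic, continuous pi} ->
  credal_set_cloud lo hi pi pi =
    credal_set_possibility lo hi pi `&`
    credal_set_possibility lo hi (fun r => 1 - pi r).
Proof.
move=> cpi.
have compl01 (a : R) : 0 <= a <= 1 -> 0 <= 1 - a <= 1.
  by move=> /andP[a0 a1]; rewrite subr_ge0 a1 lerBlDr lerDl a0.
have flip (P : probability (measurableTypeR R) R) (a : R) :
    supported_in lo hi P ->
    ((1 - a)%:E <= P (strict_cut lo hi (fun r => (1 - pi r)%R) a))%E =
    (P (weak_cut lo hi pi (1 - a)%R) <= a%:E)%E.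
  move=> PI; rewrite supported_strict_cut_compl //.
  have mW := measurable_weak_cut (1 - a) cpi.
  have := fin_num_measure P _ mW.
  move/fineK => <-.
  by rewrite -EFinB !lee_fin lerD2l lerN2.
apply/seteqP; split=> P.
  move=> [PI cut]; split; split=> // a a01; first by case: (cut a a01).
  rewrite flip //; have [] := cut _ (compl01 _ a01).
  by rewrite subKr.
move=> [[PI lower] [_ upper]]; split=> // a a01; split; last exact: lower.
by have := upper _ (compl01 _ a01); rewrite flip // subKr.
Qed.

(** * Measurable right inverses of continuous functions *)

(** The right inverse sends [y] to the last point of [[a, b]] where [f] does
    not exceed [y]; beyond that point [f] stays above [y], so the intermediate
    value theorem forbids a value below [y] there.  Replacing [y] by the
    maximum of [f a] and [y] keeps the set of candidates nonempty for all [y],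
    which makes the choice monotone on the whole line. *)
Lemma monotone_right_inverse (R : realType) (a b : R) (f : R -> R) :
  a <= b -> {within `[a, b]%classic, continuous f} ->
  exists s : R -> R,
    [/\ nondecreasing_fun s,
        (forall y, s y \in `[a, b]) &
        (forall y, f a <= y <= f b -> f (s y) = y)].
Proof.
move=> ab cf.
pose below y := [set t | t \in `[a, b] /\ f t <= Num.max (f a) y].
have below_a y : below y a.
  by split; rewrite ?in_itv /= ?lexx ?ab // le_max lexx.
have ub_below y : ubound (below y) b.
  by move=> t [/itvP tI _]; rewrite tI.
have sup_below y : has_sup (below y).
  by split; [exists a | exists b].
have supI y : sup (below y) \in `[a, b].
  rewrite in_itv /=; apply/andP; split.
    by apply: ub_le_sup; [exists b | exact: below_a].
  by apply: ge_sup; [exists a | exact: ub_below].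
have closed_below y : closed (below y).
  have -> : below y =
      f @^-1` [set z | z <= Num.max (f a) y] `&` `[a, b]%classic.
    by apply/seteqP; split=> t [].
  have cI : closed `[a, b]%classic by exact: interval_closed.
  rewrite (closed_setIS _ cI).
  by move/continuous_closedP: cf; apply; exact: closed_le.
exists (fun y => sup (below y)); split=> //.
  move=> y z yz; apply: le_sup; [|by exists a|exact: sup_below].
  move=> t [tI ft]; exists t; split=> //; split=> //.
  apply: (le_trans ft).
  by rewrite ge_max !le_max lexx yz orbT.
move=> y /andP[fay yfb].
have [_] : below y (sup (below y)).
  rewrite [X in X (sup _)](closure_id _).1 //.
  by apply: closure_sup; [exists a | exists b].
rewrite max_r // => fs_le.
have /andP[as_ sb] := supI y; rewrite !bnd_simp in as_ sb.
have [||c cI fc] := @IVT R f (sup (below y)) b y sb.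
- apply: continuous_subspaceW cf => t /=; rewrite !in_itv /= => /andP[st ->].
  by rewrite andbT (le_trans as_).
- by rewrite ge_min fs_le le_max yfb orbT.
(* [f c = y] makes [c] a candidate, so [c] cannot exceed the supremum. *)
suff -> : sup (below y) = c by [].
apply/eqP; rewrite eq_le; move: cI; rewrite in_itv /= => /andP[sc cb].
rewrite sc /=; apply: ub_le_sup; first by exists b.
by split; rewrite ?in_itv /= ?cb ?andbT ?(le_trans as_) // fc max_r.
Qed.

(** When [f] takes the low value to the right of the high one, the monotone
    construction applies to the mirror image of [f]. *)
Lemma measurable_right_inverse (R : realType) (lo hi x0 x1 : R) (f : R -> R) :
  {within `[lo, hi]%classic, continuous f} ->
  x0 \in `[lo, hi] -> x1 \in `[lo, hi] ->
  exists s : R -> R,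
    [/\ measurable_fun [set: R] s,
        (forall y, s y \in `[lo, hi]) &
        (forall y, f x0 <= y <= f x1 -> f (s y) = y)].
Proof.
move=> cf x0I x1I.
have sub (u v : R) : u \in `[lo, hi] -> v \in `[lo, hi] ->
    `[u, v]%classic `<=` `[lo, hi]%classic.
  move=> uI vI t /=; rewrite !in_itv /= => /andP[ut tv].
  by rewrite (le_trans _ ut) ?(itvP uI) // (le_trans tv) ?(itvP vI).
have [x01|/ltW x10] := leP x0 x1.
  have [s [s_nd sI fs]] := monotone_right_inverse x01
    (continuous_subspaceW (sub _ _ x0I x1I) cf).
  exists s; split=> //; first exact: nondecreasing_measurable.
  by move=> y; exact: (sub _ _ x0I x1I _ (sI y)).
have [||s [s_nd sI fs]] := @monotone_right_inverse R (- x0) (- x1) (f \o -%R).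
- by rewrite lerN2.
- apply: within_continuous_compN; rewrite !opprK.
  exact: continuous_subspaceW (sub _ _ x1I x0I) cf.
exists (fun y => - s y); split.
- by apply/measurable_funN; exact: nondecreasing_measurable.
- move=> y; apply: (sub _ _ x1I x0I) => /=.
  by have := sI y; rewrite -oppr_itvcc.
- by move=> y; rewrite /= !opprK in fs *; exact: fs.
Qed.

(** * The uniform law transported by a right inverse *)

Lemma uniform_prob01E (R : realType) (U : set (measurableTypeR R)) :
  measurable U ->
  uniform_prob (@ltr01 R) U = lebesgue_measure (U `&` `[0, 1]%classic).
Proof.
move=> mU; rewrite /uniform_prob integral_uniform_pdf.
rewrite (eq_integral (fun=> 1%:E)).
  by rewrite integral_cst ?mul1e //; exact: measurableI.
move=> x; rewrite inE /= in_itv /= /uniform_pdf => -[_ ->].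
by rewrite subr0 invr1.
Qed.

(** The law of [s] under the uniform probability gives the cuts of [pi] at
    level [a] the lengths of [[a, 1]] and [(a, 1]], which are both [1 - a]. *)
Lemma credal_set_nonempty_of_right_inverse (R : realType) (lo hi : R)
    (pi s : R -> R) :
  {within `[lo, hi]%classic, continuous pi} ->
  measurable_fun [set: R] s ->
  (forall y, s y \in `[lo, hi]) ->
  (forall y, 0 <= y <= 1 -> pi (s y) = y) ->
  credal_set_cloud lo hi pi pi !=set0.
Proof.
move=> cpi ms sI pis.
(* The Borel structures of [R] and [measurableTypeR R] have the same measurable
   sets but different displays. *)
pose S : {mfun measurableTypeR R >-> measurableTypeR R} :=
  HB.pack s
    (@isMeasurableFun.Build _ _ (measurableTypeR R) (measurableTypeR R) s ms).
have [P lawE] : exists P : probability (measurableTypeR R) R,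
    forall A : set (measurableTypeR R), measurable A ->
    P A = lebesgue_measure (s @^-1` A `&` `[0, 1]%classic).
  exists (distribution (uniform_prob (@ltr01 R)) S) => A mA.
  apply: uniform_prob01E.
  by rewrite -[_ @^-1` _]setTI; exact: (ms measurableT).
exists P; split.
  rewrite /supported_in lawE //.
  have -> : s @^-1` `[lo, hi]%classic = setT.
    by apply/seteqP; split=> // y _; exact: sI.
  by rewrite setTI lebesgue_measure_itv /= lte_fin ltr01 oppr0 adde0.
move=> a /andP[a0 a1].
have len (x y : bool) :
    lebesgue_measure [set` Interval (BSide x a) (BSide y (1 : R))] = (1 - a)%:E.
  rewrite lebesgue_measure_itv /= lte_fin; case: ltP => // a1'.
  by rewrite (_ : a = 1) ?subrr //; apply/le_anti; rewrite a1.
rewrite !lawE; [|exact: measurable_strict_cut|exact: measurable_weak_cut].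
have -> : s @^-1` weak_cut lo hi pi a `&` `[0, 1]%classic = `[a, 1]%classic.
  apply/seteqP; split=> y /=; rewrite !in_itv /=.
    by move=> [[_ +] y01]; rewrite pis // => ->; case/andP: y01.
  move=> /andP[/[dup] ay /(le_trans a0) y0 y1].
  by rewrite y1 y0 /weak_cut /= pis ?y1 ?y0.
have -> : s @^-1` strict_cut lo hi pi a `&` `[0, 1]%classic = `]a, 1]%classic.
  apply/seteqP; split=> y /=; rewrite !in_itv /=.
    by move=> [[_ +] y01]; rewrite pis // => ->; case/andP: y01.
  move=> /andP[/[dup] ay /ltW /(le_trans a0) y0 y1].
  by rewrite y1 y0 /strict_cut /= pis ?y1 ?y0.
by rewrite !len.
Qed.

Unset Implicit Arguments.
Set Strict Implicit.

Theorem proposition10 (R : realType) (lo hi : R) (pi : R -> R)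
    (pi_continuous : {within `[lo, hi]%classic, continuous pi})
    (pi_possibility : possibility_distribution lo hi pi)
    (pi_thin : thin_cloud lo hi pi pi) :
  credal_set_cloud lo hi pi pi =
    credal_set_possibility lo hi pi `&`
    credal_set_possibility lo hi (fun r => 1 - pi r) /\
  credal_set_cloud lo hi pi pi !=set0.
Proof.
split; first exact: credal_set_thin_cloudE.
have [[_ _ _ [x0 x0I pi0] [x1 x1I pi1]] _] := pi_thin.
have [s [ms sI pis]] := measurable_right_inverse pi_continuous x0I x1I.
rewrite pi0 pi1 in pis.
exact: credal_set_nonempty_of_right_inverse ms sI pis.
Qed.
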